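(* Let $X$ be a Banach space. Then $(\mathcal{N}'(X), d)$ is a complete metric space. Moreover, if $\mathfrak{U}$ is a nontrivial ultrafilter over $\mathbb{N}$ and $\left(\overline{\|\cdot\|}_n\right)_{n\in\mathbb{N}}$ is a sequence in $\mathcal{N}'(X)$ that $d$-converges to $\overline{\|\cdot\|}\in\mathcal{N}'(X)$, then there exist representatives $\|\cdot\|_n \in \overline{\|\cdot\|}_n$ and $\|\cdot\|\in\overline{\|\cdot\|}$ such that for each $x \in X$ $$\|x\| = \lim_{\mathfrak{U}} \|x\|_n .$$
   Context: For a Banach space $X$, $\mathcal{N}(X)$ is the family of all norms on $X$ equivalent to the given norm. Two norms $\|\cdot\|_1,\|\cdot\|_2\in\mathcal{N}(X)$ are collinear, written $\|\cdot\|_1\sim_c\|\cdot\|_2$, if there is $c>0$ with $\|x\|_2=c\|x\|_1$ for all $x\in X$; this is an equivalence relation and $\mathcal{N}'(X)=\mathcal{N}(X)/\sim_c$. For $\|\cdot\|_1,\|\cdot\|_2\in\mathcal{N}(X)$ let $u\ge l>0$ be the sharp constants (largest possible $l$, smallest possible $u$) such that $l\|x\|_2\le\|x\|_1\le u\|x\|_2$ for all $x\in X$, and put $\varrho(\|\cdot\|_1,\|\cdot\|_2)=u/l$. On $\mathcal{N}'(X)$ one defines $d\left(\overline{\|\cdot\|}_1,\overline{\|\cdot\|}_2\right)=\log\varrho(\|\cdot\|_1,\|\cdot\|_2)$ for any representatives $\|\cdot\|_1\in\overline{\|\cdot\|}_1$, $\|\cdot\|_2\in\overline{\|\cdot\|}_2$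 (the value does not depend on the representatives). A nontrivial ultrafilter over $\mathbb{N}$ is an ultrafilter containing no finite set. For a family $(x_i)_{i\in I}$ in a topological space and an ultrafilter $\mathfrak{U}$ on $I$, $x=\lim_{\mathfrak{U}}x_i$ means that $\{i\in I : x_i\in V\}\in\mathfrak{U}$ for every neighborhood $V$ of $x$. *)

(* Defs.v *)
From HB Require Import structures.
From mathcomp Require Import all_boot all_order all_algebra.
From mathcomp Require Import complex.
From mathcomp Require Import all_classical all_reals all_analysis.

Set Implicit Arguments.
Unset Strict Implicit.
Unset Printing Implicit Defensive.

Import Order.TTheory GRing.Theory Num.Theory.
Import numFieldNormedType.Exports.

Local Open Scope classical_set_scope.
Local Open Scope ring_scope.
Local Open Scope quotient_scope.

(* A Banach space is over the reals or over the complex numbers. *)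
Inductive scalar_kind := RealScalars | ComplexScalars.

Definition scalars (R : realType) (k : scalar_kind) : numFieldType :=
  match k with
  | RealScalars => R
  | ComplexScalars => R[i]
  end.

(* In the library the norm of a normed module takes its values (nonnegative
   reals) in the field of scalars; this reads them back as elements of R. *)
Definition real_part (R : realType) (k : scalar_kind) : scalars R k -> R :=
  match k with
  | RealScalars => id
  | ComplexScalars => @complex.Re R
  end.

Section Norms.
Context (R : realType) (k : scalar_kind) (X : normedModType (scalars R k)).

Definition is_norm (p : X -> R) : Prop :=
  [/\ forall x, 0 <= p x,
      forall x, p x = 0 -> x = 0,
      forall (a : scalars R k) x, p (a *: x) = real_part `|a| * p x &
      forall x y, p (x + y) <= p x + p y].

Definition equivalent_to_given_norm (p : X -> R) : Prop :=
  exists m M : R, [/\ 0 < m, 0 < M &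
    forall x, m * real_part `|x| <= p x <= M * real_part `|x|].

Record eqnorm := EqNorm {
  eqnorm_fun :> X -> R ;
  eqnormP : is_norm eqnorm_fun ;
  eqnorm_equiv : equivalent_to_given_norm eqnorm_fun }.

HB.instance Definition _ := gen_eqMixin eqnorm.
HB.instance Definition _ := gen_choiceMixin eqnorm.

Definition collinear (p q : eqnorm) : bool :=
  `[< exists2 c : R, 0 < c & forall x, q x = c * p x >].

Lemma collinear_refl : reflexive collinear.
Proof. by move=> p; apply/asboolP; exists 1 => // x; rewrite mul1r. Qed.

Lemma collinear_sym : symmetric collinear.
Proof.
suff sub p q : collinear p q -> collinear q p.
  by move=> p q; apply/idP/idP; exact: sub.
move=> /asboolP[c c0 pq]; apply/asboolP; exists c^-1; first by rewrite invr_gt0.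
by move=> x; rewrite pq mulKf// gt_eqF.
Qed.

Lemma collinear_trans : transitive collinear.
Proof.
move=> q p r /asboolP[c c0 pq] /asboolP[e e0 qr]; apply/asboolP.
by exists (e * c); [exact: mulr_gt0 | move=> x; rewrite qr pq mulrA].
Qed.

Canonical collinear_equiv :=
  EquivRel collinear collinear_refl collinear_sym collinear_trans.

Definition eqnorm_class := {eq_quot collinear_equiv}.
HB.instance Definition _ : EqQuotient _ collinear_equiv eqnorm_class :=
  EqQuotient.on eqnorm_class.
HB.instance Definition _ := Choice.on eqnorm_class.

Definition upper_const (p q : X -> R) : R :=
  inf [set u | 0 < u /\ forall x, p x <= u * q x].

Definition lower_const (p q : X -> R) : R :=
  sup [set l | 0 < l /\ forall x, l * q x <= p x].

(* If X = {0} the second set has no supremum and both constants are 0 by the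
   library's conventions; then rho = 0 and ln 0 = 0, so that the distance on
   the one-point space of classes is 0. *)
Definition rho (p q : X -> R) : R := upper_const p q / lower_const p q.

Definition class_dist (A B : eqnorm_class) : R := ln (rho (repr A) (repr B)).

End Norms.

Arguments class_dist {R k X} A B.

Definition is_metric (R : realType) (T : Type) (d : T -> T -> R) : Prop :=
  [/\ forall x y, 0 <= d x y,
      forall x y, d x y = 0 <-> x = y,
      forall x y, d x y = d y x &
      forall x y z, d x z <= d x y + d y z].

Definition dist_cvg (R : realType) (T : Type) (d : T -> T -> R)
    (u : nat -> T) (l : T) : Prop :=
  (fun n => d (u n) l) @ \oo --> (0 : R).

Definition dist_cauchy (R : realType) (T : Type) (d : T -> T -> R)
    (u : nat -> T) : Prop :=
  forall e : R, 0 < e -> exists N : nat, forall m n : nat,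
    (N <= m)%N -> (N <= n)%N -> d (u m) (u n) < e.

Definition is_complete_metric (R : realType) (T : Type) (d : T -> T -> R) :
    Prop :=
  is_metric d /\
  forall u : nat -> T, dist_cauchy d u -> exists l : T, dist_cvg d u l.

Definition nontrivial_ultrafilter (I : Type) (U : set_system I) : Prop :=
  UltraFilter U /\ forall A : set I, finite_set A -> ~ U A.

Section ClassDist.
Context (R : realType).

Lemma sup_pscale (c : R) (A : set R) : 0 < c ->
  sup [set c * x | x in A] = c * sup A.
Proof.
move=> c0; have [hA|hA] := pselect (has_sup A); last first.
  rewrite (sup_out hA) mulr0 sup_out// => -[[_ [x Ax _]] [M ubM]]; apply: hA.
  split; first by exists x.
  exists (c^-1 * M) => y Ay; rewrite ler_pdivlMl//; apply: ubM.
  by exists y.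
apply/eqP; rewrite eq_le; apply/andP; split.
  apply: ge_sup; first by case: hA => [[x Ax] _]; exists (c * x), x.
  move=> _ [x Ax <-]; rewrite ler_pM2l//; apply: ub_le_sup => //.
  by case: hA.
rewrite -ler_pdivlMl//; apply: ge_sup; first by case: hA.
move=> x Ax; rewrite ler_pdivlMl//; apply: ub_le_sup; last by exists x.
case: hA => _ [M ubM]; exists (c * M) => _ [y Ay <-].
by rewrite ler_pM2l//; exact: ubM.
Qed.

Lemma inf_pscale (c : R) (A : set R) : 0 < c ->
  inf [set c * x | x in A] = c * inf A.
Proof.
move=> c0; rewrite /inf mulrN -sup_pscale//; congr (- sup _).
apply/seteqP; split=> _ [_ [x Ax <-] <-].
  by exists (- x); [exists x | rewrite mulrN].
by exists (c * x); [exists x | rewrite mulrN].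
Qed.

Context (k : scalar_kind) (X : normedModType (scalars R k)).

Lemma rho_scale (a b : R) (p q : X -> R) : 0 < a -> 0 < b ->
  rho (fun x => a * p x) (fun x => b * q x) = rho p q.
Proof.
move=> a0 b0; have ab0 : 0 < a / b by rewrite divr_gt0.
have E (c x : R) : (a / b * c) * (b * x) = a * (c * x).
  by rewrite mulrACA mulfVK ?gt_eqF.
have D (c : R) : a / b * ((a / b)^-1 * c) = c by rewrite mulVKf// gt_eqF.
rewrite /rho.
have -> : upper_const (fun x => a * p x) (fun x => b * q x) =
    a / b * upper_const p q.
  rewrite -inf_pscale//; congr inf; apply/seteqP; split.
    move=> u [u0 pq]; exists ((a / b)^-1 * u) => //.
    split=> [|x]; first by rewrite mulr_gt0// invr_gt0.
    by have := pq x; rewrite -{1}(D u) E ler_pM2l.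
  move=> _ [u [u0 pq] <-]; split=> [|x]; first by rewrite mulr_gt0.
  by rewrite E ler_pM2l.
have -> : lower_const (fun x => a * p x) (fun x => b * q x) =
    a / b * lower_const p q.
  rewrite -sup_pscale//; congr sup; apply/seteqP; split.
    move=> u [u0 pq]; exists ((a / b)^-1 * u) => //.
    split=> [|x]; first by rewrite mulr_gt0// invr_gt0.
    by have := pq x; rewrite -{1}(D u) E ler_pM2l.
  move=> _ [u [u0 pq] <-]; split=> [|x]; first by rewrite mulr_gt0.
  by rewrite E ler_pM2l.
by rewrite -mulf_div divff ?mul1r// gt_eqF.
Qed.

Lemma class_distE (p q : eqnorm X) :
  class_dist (\pi_(eqnorm_class X) p) (\pi_(eqnorm_class X) q) = ln (rho p q).
Proof.
have repr_scale (r : eqnorm X) : exists2 c : R, 0 < c &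
    (repr (\pi_(eqnorm_class X) r) : X -> R) = (fun x => c * r x).
  have /eqmodP/= : repr (\pi_(eqnorm_class X) r) = r %[mod eqnorm_class X].
    by rewrite reprK.
  rewrite collinear_sym => /asboolP[c c0 rc].
  by exists c => //; apply/funext.
rewrite /class_dist; have [a a0 ->] := repr_scale p.
by have [b b0 ->] := repr_scale q; rewrite rho_scale.
Qed.

End ClassDist.

(* Main.v *)
Require Import Defs.
From HB Require Import structures.
From mathcomp Require Import all_boot all_order all_algebra.
From mathcomp Require Import complex.
From mathcomp Require Import all_classical all_reals all_analysis.

Set Implicit Arguments.
Unset Strict Implicit.
Unset Printing Implicit Defensive.

Import Order.TTheory GRing.Theory Num.Theory.
Import numFieldNormedType.Exports.

Local Open Scope classical_set_scope.
Local Open Scope ring_scope.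
Local Open Scope quotient_scope.

(** Everything rests on reading a distance bound as a two-sided estimate: for
    D >= 0, the classes of p and q are at distance at most D exactly when
    c q <= p <= c e^D q for some c > 0 ([class_dist_piP]).  The sharp constants
    are attained, so c can be taken to be the largest l with l q <= p; the
    formulation with an unspecified c also covers X = {0}, where no sharp
    constants exist.  The metric axioms follow by inverting and composing such
    estimates; distance 0 forces p = c q.

    The constant c can be removed simultaneously for all classes: if
    representatives are normalised to take the value 1 at a fixed nonzero x0,
    evaluating the estimate at x0 gives c <= 1, whence p <= e^d q with d the
    distance, and q <= e^d p by symmetry ([coherent_representatives]).  For
    these representatives d-convergence becomes uniform convergence of ratios.

    Completeness: the normalised representatives p_n of a Cauchy sequence
    satisfy p_m <= e^epsilon p_n for all large m, n.  For each x <> 0 the reals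
    ln (p_n x) are then Cauchy, so p_n x converges; the pointwise limit
    inherits the semi-norm axioms, and the inequalities with e^epsilon pass to
    the limit, which gives definiteness, equivalence with the given norm and
    d-convergence all at once ([ratio_cauchy_limit]).

    Ultrafilter limits: the normalised representatives satisfy
    e^(-d_n) q x <= p_n x <= e^(d_n) q x with d_n tending to 0, so p_n x tends
    to q x in the ordinary sense, hence along every ultrafilter containing the
    cofinite sets ([nontrivial_ultrafilter_cofinite]). *)

(** * Sharp constants between equivalent norms *)

Section EquivalentNorms.
Context (R : realType) (k : scalar_kind) (X : normedModType (scalars R k)).
Implicit Types (p q : eqnorm X) (x : X).

Lemma eqnorm_ge0 p x : 0 <= p x.
Proof. by case: (eqnormP p). Qed.

Lemma eqnorm0 p : p 0 = 0.
Proof.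
case: (eqnormP p) => _ _ hZ _; rewrite -(scale0r (0 : X)) hZ normr0.
have -> : real_part (0 : scalars R k) = 0 by case: (k).
by rewrite mul0r.
Qed.

Lemma eqnorm_gt0 p x : x != 0 -> 0 < p x.
Proof.
move=> x0; rewrite lt_def eqnorm_ge0 andbT.
by apply: contra_neq x0 => px0; have [_ + _ _] := eqnormP p; apply.
Qed.

Lemma eqnorm_dominated p q : exists2 C : R, 0 < C & forall x, p x <= C * q x.
Proof.
have [l [M [_ M0 hp]]] := eqnorm_equiv p.
have [m [L [m0 _ hq]]] := eqnorm_equiv q.
exists (M / m) => [|x]; first exact: divr_gt0.
have /andP[_ /le_trans] := hp x; apply.
rewrite -mulrA ler_pM2l// ler_pdivlMl//.
by have /andP[] := hq x.
Qed.

(** The infimum defining [upper_const] is attained: for x <> 0 the ratio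
    p x / q x is a lower bound of the admissible constants. *)
Lemma upper_constP p q x : p x <= upper_const p q * q x.
Proof.
have [->|x0] := eqVneq x 0; first by rewrite !eqnorm0 mulr0.
rewrite -ler_pdivrMr ?eqnorm_gt0//; apply: lb_le_inf.
  by have [C C0 hC] := eqnorm_dominated p q; exists C.
by move=> u [_ hu]; rewrite ler_pdivrMr ?eqnorm_gt0.
Qed.

Lemma upper_const_le p q (u : R) : 0 < u -> (forall x, p x <= u * q x) ->
  upper_const p q <= u.
Proof. by move=> u0 hu; apply: ge_inf => //; exists 0 => v [/ltW]. Qed.

Lemma lower_const_le_ratio p q x (l : R) : x != 0 ->
  l * q x <= p x -> l <= p x / q x.
Proof. by move=> x0; rewrite ler_pdivlMr ?eqnorm_gt0. Qed.

Lemma lower_constP p q x : lower_const p q * q x <= p x.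
Proof.
have [->|x0] := eqVneq x 0; first by rewrite !eqnorm0 mulr0.
rewrite -ler_pdivlMr ?eqnorm_gt0//; apply: ge_sup.
  have [C C0 hC] := eqnorm_dominated q p.
  by exists C^-1; split=> [|y]; rewrite ?invr_gt0// ler_pdivrMl.
by move=> l [_ hl]; exact: lower_const_le_ratio.
Qed.

(** The nonzero vector x bounds the admissible constants by p x / q x; without
    one they would be unbounded and their supremum meaningless. *)
Lemma lower_const_ge p q x (l : R) : x != 0 -> 0 < l ->
  (forall y, l * q y <= p y) -> l <= lower_const p q.
Proof.
move=> x0 l0 hl; apply: ub_le_sup => //; exists (p x / q x) => m [_ hm].
exact: lower_const_le_ratio.
Qed.

Lemma lower_const_gt0 p q x : x != 0 -> 0 < lower_const p q.
Proof.
move=> x0; have [C C0 hC] := eqnorm_dominated q p.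
apply: (@lt_le_trans _ _ C^-1); first by rewrite invr_gt0.
by apply: (lower_const_ge x0); rewrite ?invr_gt0// => y; rewrite ler_pdivrMl.
Qed.

Lemma rho_ge1 p q x : x != 0 -> 1 <= rho p q.
Proof.
move=> x0; rewrite /rho ler_pdivlMr ?(lower_const_gt0 _ _ x0)// mul1r.
rewrite -(@ler_pM2r _ (q x)) ?eqnorm_gt0//.
exact: le_trans (lower_constP p q x) (upper_constP p q x).
Qed.

Lemma eqnorm_trivial p x : (forall y : X, y = 0) -> p x = 0.
Proof. by move=> X0; rewrite (X0 x) eqnorm0. Qed.

Lemma trivial_or_nonzero : (forall x : X, x = 0) \/ exists x : X, x != 0.
Proof.
have [?|/existsNP[x /eqP ?]] := pselect (forall x : X, x = 0); first by left.
by right; exists x.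
Qed.

(** On the zero space every positive constant is admissible, and the default
    values of sup, of inversion and of ln make the expression vanish. *)
Lemma ln_rho_trivial p q : (forall x : X, x = 0) -> ln (rho p q) = 0.
Proof.
move=> X0; rewrite /rho; suff -> : lower_const p q = 0.
  by rewrite invr0 mulr0 ln0.
rewrite /lower_const sup_out// => -[_ [M ubM]].
have : `|M| + 1 <= M.
  apply: ubM; split=> [|x]; first by rewrite ltr_wpDl.
  by rewrite !eqnorm_trivial// mulr0.
by rewrite leNgt (le_lt_trans (ler_norm M))// ltrDl.
Qed.

Lemma ln_rho_ge0 p q : 0 <= ln (rho p q).
Proof.
have [/ln_rho_trivial->//|[x x0]] := trivial_or_nonzero.
exact/ln_ge0/(rho_ge1 p q x0).
Qed.

(** Turns the quotient of two extremal constants into an existential statement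
    that can be inverted, composed and passed to the limit.  The hypothesis
    0 <= D is what makes the equivalence hold on the zero space as well. *)
Lemma ln_rho_leP p q (D : R) : 0 <= D ->
  ln (rho p q) <= D <->
  exists2 c : R, 0 < c & forall x, c * q x <= p x <= c * expR D * q x.
Proof.
move=> D0; have [X0|[x0 x0n]] := trivial_or_nonzero.
  rewrite ln_rho_trivial//; split=> // _; exists 1 => // x.
  by rewrite !eqnorm_trivial// !mulr0 lexx.
have L0 := lower_const_gt0 p q x0n.
have rho0 : 0 < rho p q by exact: lt_le_trans (rho_ge1 p q x0n).
rewrite -[D in ln _ <= D]expRK ler_ln ?posrE ?expR_gt0//.
split=> [hD|[c c0 hc]].
  exists (lower_const p q) => // x; rewrite lower_constP/=.
  apply: le_trans (upper_constP p q x) _.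
  by rewrite ler_wpM2r ?eqnorm_ge0// mulrC -ler_pdivrMr.
rewrite /rho ler_pdivrMr//; apply: (@le_trans _ _ (c * expR D)).
  apply: upper_const_le => [|x]; first by rewrite mulr_gt0 ?expR_gt0.
  by have /andP[] := hc x.
rewrite mulrC ler_pM2l ?expR_gt0//; apply: (lower_const_ge x0n) => // x.
by have /andP[] := hc x.
Qed.

(** * The metric on classes of collinear norms *)

Lemma pi_eqP p q : \pi_(eqnorm_class X) p = \pi_(eqnorm_class X) q <->
  exists2 c : R, 0 < c & forall x, q x = c * p x.
Proof. by split=> [/eqmodP/asboolP|h]//; apply/eqmodP/asboolP. Qed.

Lemma class_dist_ge0 (A B : eqnorm_class X) : 0 <= class_dist A B.
Proof. exact: ln_rho_ge0. Qed.

Lemma class_dist_piP p q (D : R) : 0 <= D ->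
  class_dist (\pi_(eqnorm_class X) p) (\pi_(eqnorm_class X) q) <= D <->
  exists2 c : R, 0 < c & forall x, c * q x <= p x <= c * expR D * q x.
Proof. by rewrite class_distE; exact: ln_rho_leP. Qed.

Lemma class_dist_eq0 (A B : eqnorm_class X) : class_dist A B = 0 <-> A = B.
Proof.
rewrite -[A]reprK -[B]reprK; split=> [d0|/pi_eqP[c c0 hc]].
  have /(class_dist_piP _ _ (lexx 0))[c c0 hc] :
      class_dist (\pi_(eqnorm_class X) (repr A))
                 (\pi_(eqnorm_class X) (repr B)) <= 0 by rewrite d0.
  apply/esym/pi_eqP; exists c => // x; apply/le_anti.
  by have := hc x; rewrite expR0 mulr1 andbC.
apply/le_anti; rewrite class_dist_ge0 andbT.
apply/(class_dist_piP _ _ (lexx 0)).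
exists c^-1 => [|x]; first by rewrite invr_gt0.
by rewrite expR0 mulr1 hc mulKf ?gt_eqF// lexx.
Qed.

(** From c q <= p <= c e^d q one gets c' p <= q <= c' e^d p with
    c' = 1 / (c e^d). *)
Lemma class_dist_sym (A B : eqnorm_class X) : class_dist A B = class_dist B A.
Proof.
suff sub (C D : eqnorm_class X) : class_dist C D <= class_dist D C.
  by apply/le_anti; rewrite !sub.
rewrite -[C]reprK -[D]reprK; apply/class_dist_piP; first exact: class_dist_ge0.
set d := class_dist _ _.
have [c c0 hc] := (class_dist_piP _ _ (class_dist_ge0 _ _)).1 (lexx d).
have ce0 : 0 < c * expR d by rewrite mulr_gt0 ?expR_gt0.
exists (c * expR d)^-1 => [|x]; first by rewrite invr_gt0.
have /andP[h1 h2] := hc x; rewrite ler_pdivrMl// h2/=.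
by rewrite invfM mulfVK ?gt_eqF ?expR_gt0// ler_pdivlMl.
Qed.

Lemma class_dist_triangle (A B C : eqnorm_class X) :
  class_dist A C <= class_dist A B + class_dist B C.
Proof.
rewrite -[A]reprK -[B]reprK -[C]reprK.
apply/class_dist_piP; first by rewrite addr_ge0 ?class_dist_ge0.
set d := class_dist _ _; set e := class_dist _ _.
have [a a0 ha] := (class_dist_piP _ _ (class_dist_ge0 _ _)).1 (lexx d).
have [b b0 hb] := (class_dist_piP _ _ (class_dist_ge0 _ _)).1 (lexx e).
exists (a * b) => [|x]; first exact: mulr_gt0.
have /andP[a1 a2] := ha x; have /andP[b1 b2] := hb x; apply/andP; split.
  by apply: le_trans a1; rewrite -mulrA ler_pM2l.
apply: (le_trans a2); rewrite expRD mulrACA -[leRHS]mulrA ler_pM2l//.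
by rewrite mulr_gt0 ?expR_gt0.
Qed.

Lemma class_dist_is_metric : is_metric (@class_dist R k X).
Proof.
split; [exact: class_dist_ge0|exact: class_dist_eq0|exact: class_dist_sym|].
exact: class_dist_triangle.
Qed.

(** * Normalised representatives *)

Lemma scaled_eqnorm p (c : R) : 0 < c ->
  exists q : eqnorm X, forall x, q x = c * p x.
Proof.
move=> c0; have [p1 p2 p3 p4] := eqnormP p.
have cp_norm : is_norm (fun x => c * p x).
  split=> [x|x /eqP|a x|x y].
  - by rewrite mulr_ge0// ltW.
  - by rewrite mulf_eq0 gt_eqF//= => /eqP/p2.
  - by rewrite p3 mulrCA.
  - by rewrite -mulrDr ler_pM2l.
suff cp_equiv : equivalent_to_given_norm (fun x => c * p x).
  by exists (EqNorm cp_norm cp_equiv).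
have [m [M [m0 M0 h]]] := eqnorm_equiv p.
exists (c * m), (c * M); split=> [||x]; rewrite ?mulr_gt0//.
by rewrite -!mulrA !ler_pM2l.
Qed.

(** Normalising at a fixed x0 <> 0 pins down the free constant of
    [class_dist_piP]: evaluated at x0, c q <= p reads c <= 1.  The point is that
    one choice of representatives serves for all pairs of classes. *)
Lemma coherent_representatives : exists2 r : eqnorm_class X -> eqnorm X,
  forall A, \pi_(eqnorm_class X) (r A) = A &
  forall A B x, r A x <= expR (class_dist A B) * r B x.
Proof.
have [X0|[x0 x0n]] := trivial_or_nonzero.
  exists repr => [A|A B x]; first exact: reprK.
  by rewrite !eqnorm_trivial// mulr0.
have norm1 (A : eqnorm_class X) :
    exists p, \pi_(eqnorm_class X) p = A /\ p x0 = 1.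
  have rA0 := eqnorm_gt0 (repr A) x0n.
  have [p hp] : exists p, forall x, p x = (repr A x0)^-1 * repr A x.
    by apply: scaled_eqnorm; rewrite invr_gt0.
  exists p; split; last by rewrite hp mulVf ?gt_eqF.
  rewrite -[RHS]reprK; apply/esym/pi_eqP.
  by exists (repr A x0)^-1; rewrite ?invr_gt0.
have [r hr] := choice norm1; exists r => [A|A B x]; first by case: (hr A).
have [rA A1] := hr A; have [rB B1] := hr B.
have -> : class_dist A B = class_dist (\pi_(eqnorm_class X) (r A))
    (\pi_(eqnorm_class X) (r B)) by rewrite rA rB.
set d := class_dist _ _.
have [c c0 hc] := (class_dist_piP _ _ (class_dist_ge0 _ _)).1 (lexx d).
have /andP[_ /le_trans] := hc x; apply.
rewrite ler_wpM2r ?eqnorm_ge0// ler_piMl ?expR_ge0//.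
by have /andP[] := hc x0; rewrite A1 B1 mulr1.
Qed.

(** A converse to [coherent_representatives]; the factor 2 appears because the
    ratio p / q may range over all of [e^(-D), e^D]. *)
Lemma class_dist_le_double p q (D : R) : 0 <= D ->
  (forall x, p x <= expR D * q x) -> (forall x, q x <= expR D * p x) ->
  class_dist (\pi_(eqnorm_class X) p) (\pi_(eqnorm_class X) q) <= D + D.
Proof.
move=> D0 hpq hqp; apply/class_dist_piP; first exact: addr_ge0.
exists (expR D)^-1 => [|x]; first by rewrite invr_gt0 expR_gt0.
by rewrite ler_pdivrMl ?expR_gt0// hqp expRD mulKf ?gt_eqF ?expR_gt0//=.
Qed.

End EquivalentNorms.

(** * Limits of norms *)

(** The hypothesis says that ln (a n) is a Cauchy sequence. *)
Lemma ratio_cauchy_cvg (R : realType) (a : nat -> R) : (forall n, 0 < a n) ->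
  (forall e : R, 0 < e -> exists N : nat, forall m n : nat,
     (N <= m)%N -> (N <= n)%N -> a m <= expR e * a n) ->
  cvgn a.
Proof.
move=> a0 ha.
have ln_cvg : cvgn (fun n => ln (a n)).
  apply/cauchy_cvgP/cauchy_exP => e e0.
  have e20 : 0 < e / 2 by rewrite divr_gt0.
  have [N hN] := ha _ e20; exists (ln (a N)).
  exists N => // n /= Nn; rewrite /ball/=.
  have lnle i j : a i <= expR (e / 2) * a j -> ln (a i) - ln (a j) <= e / 2.
    move=> h; rewrite lerBlDr -[e / 2]expRK -lnM ?posrE ?expR_gt0//.
    by rewrite ler_ln ?posrE ?mulr_gt0 ?expR_gt0.
  apply: (@le_lt_trans _ _ (e / 2)); last by rewrite gtr_pMr// invf_lt1// ltr1n.
  rewrite ler_norml (lnle N n) ?hN// andbT lerNl opprB.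
  by rewrite lnle// hN.
have -> : a = expR \o (fun n => ln (a n)).
  by apply/funext => n /=; rewrite lnK ?posrE.
apply/cvg_ex; exists (expR (limn (fun n => ln (a n)))).
by apply: continuous_cvg => //; exact: continuous_expR.
Qed.

Section Limits.
Context (R : realType) (k : scalar_kind) (X : normedModType (scalars R k)).

(** The inequalities p_m <= e^e p_n survive the pointwise limit in m and in n;
    comparing the limit with a single p_N then shows that it vanishes only at 0
    and is equivalent to the given norm. *)
Lemma ratio_cauchy_limit (p : nat -> eqnorm X) :
  (forall e : R, 0 < e -> exists N : nat, forall m n : nat,
     (N <= m)%N -> (N <= n)%N -> forall x, p m x <= expR e * p n x) ->
  exists q : eqnorm X, forall e : R, 0 < e -> exists N : nat, forall n : nat,
    (N <= n)%N ->
    (forall x, p n x <= expR e * q x) /\ (forall x, q x <= expR e * p n x).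
Proof.
move=> hp.
have p_cvg x : cvgn (fun n => p n x).
  have [->|x0] := eqVneq x 0.
    by under eq_fun do rewrite eqnorm0; exact: is_cvg_cst.
  apply: ratio_cauchy_cvg => [n|e e0]; first exact: eqnorm_gt0.
  by have [N hN] := hp e e0; exists N => m n Nm Nn; exact: hN.
pose q x := limn (fun n => p n x).
have q_cvg x : p n x @[n --> \oo] --> q x by exact: p_cvg.
have q_near (e : R) : 0 < e -> exists N : nat, forall n : nat, (N <= n)%N ->
    (forall x, p n x <= expR e * q x) /\ (forall x, q x <= expR e * p n x).
  move=> e0; have [N hN] := hp e e0; exists N => n Nn; split=> x.
    rewrite -ler_pdivrMl ?expR_gt0//; apply: limr_ge => //.
    by exists N => // m /= Nm; rewrite ler_pdivrMl ?expR_gt0// hN.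
  by apply: limr_le => //; exists N => // m /= Nm; rewrite hN.
have [N /(_ _ (leqnn N))[pq qp]] := q_near 1 ltr01.
have q_norm : is_norm q.
  split=> [x|x qx0|a x|x y].
  - by apply: limr_ge => //; apply: nearW => n; exact: eqnorm_ge0.
  - apply/eqP; apply: contraTT (pq x) => x0.
    by rewrite qx0 mulr0 -ltNge eqnorm_gt0.
  - rewrite /q; under eq_fun => n.
      by case: (eqnormP (p n)) => _ _ -> _; over.
    by apply/cvg_lim => //; apply: cvgM (q_cvg x); exact: cvg_cst.
  - rewrite -limD//; apply: ler_lim => //; first exact: is_cvgD.
    by apply: nearW => n; case: (eqnormP (p n)).
have q_equiv : equivalent_to_given_norm q.
  have [m [M [m0 M0 h]]] := eqnorm_equiv (p N).
  exists ((expR 1)^-1 * m), (expR 1 * M).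
  split=> [||x]; rewrite ?mulr_gt0 ?invr_gt0 ?expR_gt0//.
  have /andP[h1 h2] := h x; apply/andP; split.
    by rewrite -mulrA ler_pdivrMl ?expR_gt0// (le_trans h1).
  by apply: (le_trans (qp x)); rewrite -mulrA ler_pM2l ?expR_gt0.
by exists (EqNorm q_norm q_equiv).
Qed.

Lemma class_dist_complete (u : nat -> eqnorm_class X) :
  dist_cauchy class_dist u -> exists l, dist_cvg class_dist u l.
Proof.
move=> hu; have [r rK hr] := coherent_representatives X.
have [e e0|q hq] := @ratio_cauchy_limit (r \o u).
  have [N hN] := hu e e0; exists N => m n Nm Nn x /=.
  apply: le_trans (hr _ (u n) x) _.
  by rewrite ler_wpM2r ?eqnorm_ge0// ler_expR ltW// hN.
exists (\pi_(eqnorm_class X) q); apply/cvgrPdist_le => e e0.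
have [N hN] := hq (e / 2) (divr_gt0 e0 (ltr0Sn _ _)).
exists N => // n /hN[/= h1 h2].
rewrite sub0r normrN ger0_norm ?class_dist_ge0//.
rewrite -[u n]rK [e in _ <= e]splitr.
by apply: class_dist_le_double => //; rewrite divr_ge0// ltW.
Qed.

End Limits.

(** * Limits along ultrafilters *)

(** The complement of a cofinite set is finite, so it cannot belong to U. *)
Lemma nontrivial_ultrafilter_cofinite (U : set_system nat) :
  nontrivial_ultrafilter U -> U `=>` \oo.
Proof.
move=> [UU Ufin] S [N _ NS].
have [//|US] := in_ultra_setVsetC S UU.
case: (Ufin (~` S)) => //; apply: (sub_finite_set _ (finite_II N)).
by move=> n /= nS; rewrite ltnNge; apply/negP => /NS.
Qed.

Theorem theorem4p2 (R : realType) (k : scalar_kind)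
    (X : completeNormedModType (scalars R k)) :
  is_complete_metric (@class_dist R k X) /\
  forall (U : set_system nat) (A : nat -> eqnorm_class X) (B : eqnorm_class X),
    nontrivial_ultrafilter U ->
    dist_cvg class_dist A B ->
    exists (p : nat -> eqnorm X) (q : eqnorm X),
      [/\ forall n, \pi_(eqnorm_class X) (p n) = A n,
          \pi_(eqnorm_class X) q = B &
          forall x : X, (fun n => p n x) @ U --> q x].
Proof.
split; first by split; [exact: class_dist_is_metric|exact: class_dist_complete].
move=> U A B /nontrivial_ultrafilter_cofinite Uoo AB.
have [r rK hr] := coherent_representatives X.
exists (r \o A), (r B); split=> [n||x] //; first exact: rK.
apply: cvg_trans (cvg_app _ Uoo) _.
(* Used with s = -1 and s = 1, the two outer sequences of the squeeze. *)
have to1 (s : R) : expR (s * class_dist (A n) B) * r B x @[n --> \oo] --> r B x.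
  rewrite -[X in _ --> X]mul1r; apply: cvgM (cvg_cst _).
  rewrite -expR0 -(mulr0 s).
  by apply: continuous_cvg; [exact: continuous_expR|exact: cvgM (cvg_cst _) AB].
apply: squeeze_cvgr (to1 (-1)) (to1 1); apply: nearW => n.
rewrite mulN1r mul1r expRN hr andbT ler_pdivrMl ?expR_gt0//.
by rewrite class_dist_sym hr.
Qed.
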